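(* Let $k$ and $n$ be integers with $k\ge 6$, $n\ge 6(k-2)$ and $kn$ even. Then there exists a $k$-regular homogeneously traceable nonhamiltonian graph of order $n$.
   Context: All graphs are finite and simple. The order of a graph is its number of vertices. A graph is $k$-regular if every vertex has degree $k$. A Hamilton path (cycle) of a graph is a path (cycle) containing every vertex exactly once. A graph is nonhamiltonian if it has no Hamilton cycle. A graph $G$ is homogeneously traceable if every vertex of $G$ is an endpoint of a Hamilton path of $G$. *)

(* Defs.v *)
From mathcomp Require Import all_boot.

Set Implicit Arguments.
Unset Strict Implicit.
Unset Printing Implicit Defensive.

Record sgraph := SGraph {
  vertex :> finType;
  adj : rel vertex;
  adj_sym : symmetric adj;
  adj_irrefl : irreflexive adj
}.

Section Graph.

Variable G : sgraph.

Definition order_of : nat := #|G|.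

Definition degree (v : G) : nat := #|[set w | adj v w]|.

Definition regular (k : nat) : Prop := forall v : G, degree v = k.

(* As in path.v, the nonempty vertex sequence x :: p is passed as the pair
   of its first vertex x and its tail p; its endpoints are x and last x p. *)
Definition hamilton_path (x : G) (p : seq G) : Prop :=
  [/\ path (@adj G) x p, uniq (x :: p) & forall v : G, v \in x :: p].

Definition endpoint (v x : G) (p : seq G) : Prop := v = x \/ v = last x p.

(* A cycle of a simple graph has at least three vertices, whereas
   path.cycle also accepts [::] and the back-and-forth walk [:: x; y]. *)
Definition hamilton_cycle (c : seq G) : Prop :=
  [/\ 2 < size c, cycle (@adj G) c, uniq c & forall v : G, v \in c].

Definition nonhamiltonian : Prop := ~ exists c : seq G, hamilton_cycle c.

Definition homogeneously_traceable : Prop :=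
  forall v : G, exists (x : G) (p : seq G), hamilton_path x p /\ endpoint v x p.

End Graph.

(* Main.v *)
Require Import Defs.
From mathcomp Require Import all_boot zify.

(* Take three "pieces": graphs with two nonadjacent hubs of degree k - 2, all
   other vertices having degree k.  Joining the three first hubs by a triangle
   and the three second hubs by a triangle gives a k-regular graph.  A Hamilton
   cycle would have to traverse each piece once, from hub to hub, hence would
   use exactly one triangle edge at each first hub: a perfect matching of a
   triangle.  On the other hand Hamilton paths of the pieces concatenate to
   Hamilton paths starting anywhere.

   A piece with m > k inner vertices comes from a k-regular circulant on Z/m by
   deleting the edges {x, x + 2}, x < k - 2, and joining x to the first hub and
   x + 2 to the second.  This covers n >= 3k + 9; as n >= 6(k - 2), only
   k = 6 and n = 24, 25, 26 remain, where pieces built on K_6 minus an edge are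
   used as well. *)

(** * Pieces with two hubs and their Hamilton paths *)

Record piece (k : nat) := Piece {
  body :> sgraph;
  hub : bool -> body;
  hub_neq : hub true != hub false;
  hub_nadj : ~~ adj (hub true) (hub false);
  piece_degree : forall v : body,
    degree v + 2 * ((v == hub true) || (v == hub false)) = k;
  hub_path : exists p, [/\ path (@adj body) (hub true) p,
    last (hub true) p = hub false, uniq (hub true :: p)
    & forall v, v \in hub true :: p];
  inner_path : forall v, v != hub true -> v != hub false ->
    exists p, [/\ path (@adj body) v p, last v p = hub true, uniq (v :: p)
    & forall w, (w \in v :: p) = (w != hub false)]
}.

Arguments hub {k} p d.
Arguments hub_neq {k} p.
Arguments hub_nadj {k} p.
Arguments piece_degree {k} p v.
Arguments hub_path {k} p.
Arguments inner_path {k} p v.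

Lemma hub_inj {k} (P : piece k) : injective (hub P).
Proof. by case; case=> // E; have := hub_neq P; rewrite E eqxx. Qed.

Lemma hub_path_dir {k} (P : piece k) d : exists p,
  [/\ path (@adj P) (hub P d) p, last (hub P d) p = hub P (~~ d),
      uniq (hub P d :: p) & forall v, v \in hub P d :: p].
Proof.
have [p [pp lp up ap]] := hub_path P.
case: d; first by exists p.
have E : hub P false :: rev (belast (hub P true) p) = rev (hub P true :: p).
  by rewrite [in RHS]lastI rev_rcons lp.
exists (rev (belast (hub P true) p)); split.
- rewrite -lp rev_path.
  by rewrite -(eq_path (e := @adj P)) // => x y; apply: adj_sym.
- by rewrite -[LHS](last_cons (hub P true)) E rev_cons last_rcons.
- by rewrite E rev_uniq.
- by move=> v; rewrite E mem_rev.
Qed.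

(** The second vertex of the hub path qualifies: it is a neighbour of the first hub, and the hubs
    are not adjacent. *)
Lemma inner_exists {k} (P : piece k) :
  exists v : P, (v != hub P true) && (v != hub P false).
Proof.
have [[|v p] [pp lp _ _]] := hub_path P.
  by have := hub_neq P; rewrite -lp eqxx.
exists v; apply/andP; case/andP: pp => av _; split.
  by apply: contraL av => /eqP->; rewrite adj_irrefl.
by apply: contraL av => /eqP->; apply: hub_nadj.
Qed.

(** * How a Hamilton cycle crosses the boundary of a vertex set *)

Section CycleCut.

Variables (T : finType) (c : seq T).
Hypotheses (Uc : uniq c) (c_full : forall v, v \in c).

(** Iterating [next c] from [x] reaches every vertex, so a set closed under [next c] that contains
    [x] would contain [y]. *)
Lemma next_leaves (S : pred T) x y : S x -> ~~ S y ->
  exists z, S z && ~~ S (next c z).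
Proof.
move=> Sx nSy; case: (pickP (fun z => S z && ~~ S (next c z))) => [z Sz|none].
  by exists z.
case/negP: nSy.
have : fconnect (next c) x y.
  by rewrite (fconnect_cycle (cycle_next Uc) (c_full x)) c_full.
move/iter_findex<-; elim: findex => //= i Si.
by have /negbT := none (iter i (next c) x); rewrite Si negbK.
Qed.

Lemma next_enters (S : pred T) x y : S x -> ~~ S y ->
  exists z, ~~ S z && S (next c z).
Proof.
move=> Sx nSy; have [||z] := @next_leaves (predC S) y x; rewrite /= ?negbK //.
by exists z.
Qed.

End CycleCut.

(** * Joining three pieces along two triangles of hubs *)

Section Glue.

Variables (k : nat) (P : 'I_3 -> piece k).

Definition glue_vertex : finType := {i : 'I_3 & P i}.

Definition glue_adj (u v : glue_vertex) : bool :=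
  if tag u == tag v then adj (tagged u) (tagged_as u v)
  else [exists d, (tagged u == hub (P (tag u)) d)
               && (tagged v == hub (P (tag v)) d)].

Definition inj (i : 'I_3) (x : P i) : glue_vertex := Tagged (fun i => P i) x.

Lemma glue_adj_in i (x y : P i) : glue_adj (inj i x) (inj i y) = adj x y.
Proof. by rewrite /glue_adj /= eqxx tagged_asE. Qed.

Lemma glue_adj_out i j (x : P i) (y : P j) : i != j ->
  glue_adj (inj i x) (inj j y) = [exists d, (x == hub (P i) d) && (y == hub (P j) d)].
Proof. by rewrite /glue_adj /= => /negbTE->. Qed.

Lemma inj_inj i : injective (inj i).
Proof. by move=> x y /eqP; rewrite eq_Tagged => /eqP. Qed.

Lemma glue_adj_sym : symmetric glue_adj.
Proof.
case=> i x [j y]; case: (eqVneq i j) => [E|ne].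
  by case: j / E y => y; rewrite !glue_adj_in adj_sym.
rewrite !glue_adj_out // 1?eq_sym //.
by apply: eq_existsb => d; rewrite andbC.
Qed.

Lemma glue_adj_irrefl : irreflexive glue_adj.
Proof. by case=> i x; rewrite glue_adj_in adj_irrefl. Qed.

Definition glue : sgraph := SGraph glue_adj_sym glue_adj_irrefl.

Definition ghub i d : glue := inj i (hub (P i) d).

Lemma ghub_eq i (x : P i) d : (inj i x == ghub i d) = (x == hub (P i) d).
Proof. exact: (inj_eq (@inj_inj i)). Qed.

Lemma ghub_inj d : injective (ghub^~ d).
Proof. by move=> i j /(congr1 tag). Qed.

Lemma card_glue : order_of glue = \sum_i #|P i|.
Proof. by rewrite /order_of card_tagged sumnE big_map big_enum. Qed.

(** A neighbourhood splits into the neighbours inside the piece and, at a hub, the two hubs with the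
    same [d] in the other pieces. These two make up exactly the deficit recorded by
    [piece_degree]. *)
Lemma glue_regular : regular glue k.
Proof.
case=> i x; apply: etrans (piece_degree (P i) x); rewrite /degree.
have -> : [set w | @adj glue (Tagged (fun i => P i) x) w] =
    inj i @: [set y | adj x y] :|:
    [set w | [exists d, [exists j, [&& x == hub (P i) d, j != i & w == ghub j d]]]].
  apply/setP=> -[j y]; rewrite !inE.
  case: (eqVneq i j) => [E|ne].
    case: j / E y => y; rewrite [LHS]glue_adj_in.
    rewrite (mem_imset _ _ (@inj_inj i)) inE.
    case: existsP => [[d /existsP[j /and3P[_ ji /eqP/(congr1 tag)/= E]]]|].
      by rewrite E eqxx in ji.
    by rewrite orbF.
  rewrite [LHS]glue_adj_out //.
  have -> : (Tagged (fun i => P i) y \in inj i @: [set y0 | adj x y0]) = false.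
    by apply/imsetP=> -[z _ /(congr1 tag)/= E]; rewrite E eqxx in ne.
  apply: eq_existsb => d.
  apply/andP/existsP=> [[xd yd]|[j' /and3P[xd _ /eqP E]]].
    by exists j; rewrite xd (eq_sym j) ne /=; move: yd; rewrite -ghub_eq.
  move: (congr1 tag E) => /= Ej; case: j' / Ej E => /eqP.
  by rewrite (ghub_eq _ y d).
rewrite cardsU (_ : _ :&: _ = set0) ?cards0 ?subn0; last first.
  apply/setP=> w; rewrite !inE; apply/negP=> /andP[/imsetP[y _ ->]].
  case/existsP=> d /existsP[j /and3P[_ ji /eqP/(congr1 tag)/= E]].
  by rewrite E eqxx in ji.
rewrite card_imset; last exact: inj_inj.
congr (_ + _).
have hubs d : x = hub (P i) d -> #|[set w | [exists d0, [exists j,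
   [&& x == hub (P i) d0, j != i & w == ghub j d0]]]]| = 2.
  move=> xd; transitivity #|[set ghub j d | j in [set~ i]]|.
    congr #|pred_of_set _|; apply/setP=> w; rewrite inE.
    apply/existsP/imsetP=> [[d0 /existsP[j /and3P[/eqP x0 ji /eqP->]]]|[j]].
      have -> : d = d0 by apply: (hub_inj (P i)); rewrite -xd.
      by exists j; rewrite ?inE.
    rewrite !inE => ji ->; exists d; apply/existsP; exists j.
    by rewrite xd ji !eqxx.
  by rewrite card_imset ?cardsC1 ?card_ord //; apply: ghub_inj.
case: (eqVneq x (hub (P i) true)) => [/hubs->//|xt].
case: (eqVneq x (hub (P i) false)) => [/hubs->//|xf].
apply/eqP; rewrite cards_eq0; apply/eqP/setP=> w; rewrite !inE.
apply/existsP=> -[d /existsP[j /andP[/eqP xd _]]].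
by case: d xd xt xf => ->; rewrite eqxx.
Qed.

Lemma lift_path i (x : P i) p : path (@adj (P i)) x p ->
  path (@adj glue) (inj i x) (map (inj i) p).
Proof. by rewrite path_map; apply: sub_path => y z; rewrite /= glue_adj_in. Qed.

Lemma lift_uniq i (s : seq (P i)) : uniq (map (inj i) s) = uniq s.
Proof. by rewrite map_inj_uniq //; apply: inj_inj. Qed.

Lemma mem_lift i (s : seq (P i)) (A : pred glue) :
  (forall y, (y \in s) = A (inj i y)) ->
  forall v : glue, (v \in map (inj i) s) = (tag v == i) && A v.
Proof.
move=> sA [j y] /=; case: eqVneq => [E|ne].
  by case: i / E s sA => s sA; rewrite mem_map ?sA //; apply: inj_inj.
by apply/mapP=> -[z _ /(congr1 tag)/= E]; rewrite E eqxx in ne.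
Qed.

Lemma cross i d : exists p, [/\ path (@adj glue) (ghub i d) p,
  last (ghub i d) p = ghub i (~~ d), uniq (ghub i d :: p)
  & forall v, (v \in ghub i d :: p) = (tag v == i)].
Proof.
have [p [pp lp up ap]] := hub_path_dir (P i) d.
exists (map (inj i) p); split.
- exact: lift_path.
- by rewrite /ghub last_map lp.
- by rewrite -[_ :: _]/(map (inj i) (hub (P i) d :: p)) lift_uniq.
- move=> v; have := mem_lift i (hub (P i) d :: p) predT ap v.
  by rewrite andbT.
Qed.

Lemma ghub_adj i j d : i != j -> glue_adj (ghub i d) (ghub j d).
Proof. by move=> ij; rewrite glue_adj_out //; apply/existsP; exists d; rewrite !eqxx. Qed.

(** The witnesses are the cyclic successor and predecessor of [i] modulo 3. *)
Lemma others (i : 'I_3) : exists j l : 'I_3,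
  [/\ i != j, i != l, j != l & forall t, [|| t == i, t == j | t == l]].
Proof.
exists (ordS i), (ord_pred i).
by case: i => -[|[|[|//]]] ?; split=> // -[[|[|[|//]]] ?].
Qed.

Lemma glue_traceable : homogeneously_traceable glue.
Proof.
suff start (v : glue) : exists p, hamilton_path v p.
  by move=> v; have [p hp] := start v; exists v, p; split; last left.
case: v => i x; have [j [l [ij il jl cov]]] := others i.
have neq_sym := (eq_sym j i, eq_sym l i, eq_sym l j).
case: (boolP [exists d, x == hub (P i) d]) => [/existsP[d /eqP->]|inner].
  change (exists p, hamilton_path (ghub i d) p).
  have [p [pp lp up ap]] := cross i d.
  have [q [pq lq uq aq]] := cross j (~~ d).
  have [r [pr lr ur ar]] := cross l d.
  (* Each crossing ends at the hub opposite to its start, so the starting hubs alternate along [i],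
     [j], [l]. *)
  exists (p ++ (ghub j (~~ d) :: q) ++ (ghub l d :: r)).
  split.
  - rewrite cat_path pp lp /= ghub_adj // cat_path pq lq negbK /= pr andbT.
    exact: ghub_adj.
  - rewrite -cat_cons !cat_uniq up uq ur !andTb andbT.
    apply/andP; split; apply/hasPn=> v.
      rewrite mem_cat aq ar ap => /orP[/eqP->|/eqP->]; by rewrite neq_sym.
    by rewrite aq ar => /eqP->; rewrite neq_sym.
  - by move=> v; rewrite -cat_cons !mem_cat ap aq ar; apply: cov.
have [xt xf] : x != hub (P i) true /\ x != hub (P i) false.
  by split; apply: contra inner => /eqP->; apply/existsP; eexists.
change (exists p, @hamilton_path glue (inj i x) p).
have [p [pp lp up ap]] := inner_path (P i) x xt xf.
have [q [pq lq uq aq]] := cross j true.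
have [r [pr lr ur ar]] := cross l false.
have ap' v : (v \in inj i x :: map (inj i) p) = (tag v == i) && (v != ghub i false).
  apply: (mem_lift i (x :: p) (fun v => v != ghub i false)) => y.
  by rewrite ap ghub_eq.
(* The path inside piece [i] ends at its first hub and omits the second. Crossing piece [j] leads
   from the first triangle to the second, where the omitted hub is picked up on the way to piece
   [l]. *)
exists (map (inj i) p ++ (ghub j true :: q) ++ ghub i false :: ghub l false :: r).
split.
- rewrite cat_path lift_path //= last_map lp ghub_adj //= cat_path pq lq /= pr andbT.
  by rewrite !ghub_adj // eq_sym.
- have uf : uniq (ghub i false :: ghub l false :: r).
    by rewrite cons_uniq ur ar il.
  rewrite -cat_cons !cat_uniq uq uf -map_cons lift_uniq up !andTb andbT.
  apply/andP; split; apply/hasPn=> v.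
    rewrite mem_cat aq inE ar ap' negb_and negbK.
    case/or3P=> /eqP->; by rewrite ?eqxx ?orbT ?neq_sym ?(negbTE il) ?(negbTE ij).
  by rewrite aq inE ar => /orP[]/eqP->; rewrite /= 1?eq_sym ?neq_sym.
- move=> v; rewrite -cat_cons !mem_cat ap' aq inE ar.
  case/or3P: (cov (tag v)) => /eqP->; rewrite eqxx ?orbT //=.
  by case: eqVneq; rewrite ?orbT.
Qed.

(* Orient the cycle.  At the first hub of a piece, exactly one of the two
   neighbours along the cycle lies inside the piece, and the other is the first
   hub of another piece.  So the cycle matches the pieces entered through their
   first hub with those left through it, and 3 would be even. *)
Lemma glue_nonhamiltonian : nonhamiltonian glue.
Proof.
case=> c [_ cyc Uc full].
set s := next c; set s' := prev c.
have sK : cancel s s' := prev_next Uc.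
have s'K : cancel s' s := next_prev Uc.
have s_adj v : @adj glue v (s v) by apply: (next_cycle cyc).
have s'_adj v : @adj glue (s' v) v by apply: (prev_cycle cyc).
have leaves := next_leaves _ _ Uc full; have enters := next_enters _ _ Uc full.
rewrite -/s in leaves enters; clearbody s s'.
pose inner i : pred glue :=
  [pred v | [&& tag v == i, v != ghub i true & v != ghub i false]].
have innerP i v : tag v = i -> [\/ inner i v, v = ghub i true | v = ghub i false].
  rewrite /inner /= => ->; rewrite eqxx /=.
  case: eqVneq => [->|_]; first by constructor 2.
  by case: eqVneq => [->|_]; [constructor 3|constructor 1].
have inner_adj i u v : inner i u -> @adj glue u v -> tag v = i.
  case: u v => i' x [j y] /and3P[/eqP/= E]; case: i / E => xt xf.
  case: (eqVneq i' j) => // ne; rewrite glue_adj_out // => /existsP[d /andP[xd _]].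
  by move: xt xf; rewrite !ghub_eq; case: d xd => ->.
have adj_inner i u v : inner i u -> @adj glue v u -> tag v = i.
  by rewrite adj_sym; apply: inner_adj.
have hub_adj i d v : @adj glue (ghub i d) v ->
    inner i v \/ exists2 j, i != j & v = ghub j d.
  case: v => j y; case: (eqVneq i j) => [E|ne].
    case: j / E y => y a; have {}a : adj (hub (P i) d) y by rewrite -glue_adj_in.
    left; rewrite /inner /= eqxx !ghub_eq /=.
    case: d a => a; apply/andP; split; apply: contraL a => /eqP->; rewrite ?adj_irrefl //.
      exact: hub_nadj.
    by rewrite adj_sym hub_nadj.
  move=> a; have : glue_adj (inj i (hub (P i) d)) (inj j y) := a.
  rewrite glue_adj_out // => /existsP[d' /andP[/eqP/hub_inj<- /eqP->]].
  by right; exists j.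
have ghub_out i j d : inner i (ghub j d) = false.
  rewrite /inner /=; case: eqVneq => //= ->; rewrite !ghub_eq.
  by case: d; rewrite eqxx ?andbF.
have some_inner i : exists v, inner i v.
  have [v /andP[vt vf]] := inner_exists (P i).
  by exists (inj i v); rewrite /inner /= eqxx !ghub_eq vt.
have hub_tag i d : tag (ghub i d) = i by [].
(* [out] says that the cycle goes from the hub to an inner vertex, [inn] that it reaches the hub
   from one. *)
pose out i d := inner i (s (ghub i d)); pose inn i d := inner i (s' (ghub i d)).
have other i : exists j : 'I_3, i != j by have [j [l []]] := others i; exists j.
have leave_inner i : inn i true || inn i false.
  have [v iv] := some_inner i.
  have [x /andP[ix nsx]] := leaves (inner i) v (ghub i true) iv (negbT (ghub_out _ _ _)).
  rewrite /inn; have [isx|E|E] := innerP i (s x) (inner_adj _ _ _ ix (s_adj x)).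
  - by rewrite isx in nsx.
  - by rewrite -E sK ix.
  - by rewrite -E sK ix orbT.
have enter_inner i : out i true || out i false.
  have [v iv] := some_inner i.
  have [x /andP[nix sx]] := enters (inner i) v (ghub i true) iv (negbT (ghub_out _ _ _)).
  rewrite /out; have [ix|E|E] := innerP i x (adj_inner _ _ _ sx (s_adj x)).
  - by rewrite ix in nix.
  - by rewrite -E sx.
  - by rewrite -E sx orbT.
(* Only hubs have neighbours in other pieces, so if both hubs were followed by inner vertices the
   cycle could never leave the piece. *)
have leave_piece i : ~~ (out i true && out i false).
  have [j ij] := other i.
  have [||x /andP[/eqP tx ntx]] := leaves (fun v => tag v == i) (ghub i true) (ghub j true).
  - by rewrite hub_tag.
  - by rewrite hub_tag eq_sym.
  have [ix|E|E] := innerP i x tx.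
  - by rewrite (inner_adj _ _ _ ix (s_adj x)) eqxx in ntx.
  - by apply: contra ntx => /andP[/and3P[]]; rewrite -E.
  - by apply: contra ntx => /andP[_ /and3P[]]; rewrite -E.
have enter_piece i : ~~ (inn i true && inn i false).
  have [j ij] := other i.
  have [||x /andP[ntx /eqP tx]] := enters (fun v => tag v == i) (ghub i true) (ghub j true).
  - by rewrite hub_tag.
  - by rewrite hub_tag eq_sym.
  have [ix|E|E] := innerP i (s x) tx.
  - by rewrite (adj_inner _ _ _ ix (s_adj x)) eqxx in ntx.
  - by apply: contra ntx => /andP[/and3P[]]; rewrite -E sK.
  - by apply: contra ntx => /andP[_ /and3P[]]; rewrite -E sK.
(* Otherwise the cycle could not leave the inner vertices together with hub d. *)
have not_both i d : out i d -> inn i (~~ d).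
  move=> od.
  have [v iv] := some_inner i.
  pose S v := inner i v || (v == ghub i d).
  have [||x /andP[Sx nSsx]] := leaves S v (ghub i (~~ d)).
  - by rewrite /S iv.
  - by rewrite /S ghub_out ghub_eq /=; apply/eqP => /hub_inj; case: (d).
  case/orP: Sx nSsx => [ix|/eqP->]; rewrite /S negb_or => /andP[nix nsx]; last first.
    by rewrite /out in od; rewrite od in nix.
  have [isx|E|E] := innerP i (s x) (inner_adj _ _ _ ix (s_adj x)).
  - by rewrite isx in nix.
  - by move: nsx; rewrite /inn; case: (d) => /=; rewrite E ?eqxx // -E sK.
  - by move: nsx; rewrite /inn; case: (d) => /=; rewrite E ?eqxx // -E sK.
have inE_out i : inn i true = ~~ out i true.
  have /implyP := not_both i true; have /implyP := not_both i false.
  have := leave_inner i; have := enter_inner i.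
  have := leave_piece i; have := enter_piece i.
  by case: (inn i true) (inn i false) (out i true) (out i false) => [] [] [] [].
pose D := [set i | out i true].
(* For [i] in [D] the first hub is entered from outside its piece, hence from the first hub of
   another piece. That piece is left through its first hub, so it lies outside [D]; the converse is
   symmetric. *)
have : [set ghub i true | i in D] = [set s (ghub i true) | i in ~: D].
  apply/setP=> v; apply/imsetP/imsetP=> -[i]; rewrite !inE => oi ->.
    have : ~~ inn i true by rewrite inE_out negbK.
    rewrite /inn => ni.
    have := s'_adj (ghub i true); rewrite adj_sym => /hub_adj[ii|[j ij E]].
      by rewrite ii in ni.
    by exists j; rewrite -?E ?s'K // !inE /out -E s'K ghub_out.
  have [ii|[j ij E]] := hub_adj _ _ _ (s_adj (ghub i true)).
    by rewrite /out ii in oi.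
  exists j => //; rewrite inE -[out _ _]negbK -inE_out /inn -E sK.
  by rewrite ghub_out.
move/(congr1 (fun A : {set glue} => #|A|)).
rewrite (card_imset D (@ghub_inj true)).
rewrite (card_imset (~: D) (inj_comp (can_inj sK) (@ghub_inj true))) => E.
(* [D] and its complement have the same size, so 3 would be twice that size. *)
by have := cardsC D; rewrite card_ord -E; lia.
Qed.

End Glue.

(** * Passing between ordinals and natural numbers *)

Lemma degree_count N (e : rel nat) (v : nat) :
  #|[set w : 'I_N | e v w]| = count (e v) (iota 0 N).
Proof. by rewrite cardsE cardE -val_enum_ord count_map -size_filter enumT. Qed.

Lemma lift_seq N (s : seq nat) : all (ltn^~ N) s -> exists t : seq 'I_N, map val t = s.
Proof.
elim: s => [|x s IH] /=; first by exists [::].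
by case/andP=> xN /IH[t <-]; exists (Ordinal xN :: t).
Qed.

(** * The modified circulant: adjacency and degrees *)

Section Circulant.

Variables k m : nat.
Hypotheses (k_ge6 : 6 <= k) (km : k < m) (km_even : ~~ odd (k * m)).

(* d is a difference |v - w| of representatives in 0..m-1, so d and m - d are
   the same chord; for odd k the diameter m/2 is added. *)
Definition chord (d : nat) : bool :=
  (d != 0) && [|| d <= k./2, m - k./2 <= d | odd k && (d.*2 == m)].

Definition dropped (v w : nat) : bool := (w == v.+2) && (v < k - 2).

(* The hubs are encoded as the numbers m and m + 1. *)
Definition attached (v w : nat) : bool :=
  ((w == m) && (v < k - 2)) || ((w == m.+1) && (1 < v < k)).

Definition circ (v w : nat) : bool :=
  [&& v < m, w < m, chord ((v - w) + (w - v)), ~~ dropped v w & ~~ dropped w v]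
  || (attached v w || attached w v).

Lemma circ_sym : symmetric circ.
Proof.
move=> v w; rewrite /circ addnC [attached v w || _]orbC.
congr (_ || _); rewrite andbCA; do 3!congr (_ && _); exact: andbC.
Qed.

Lemma circ_irrefl : irreflexive circ.
Proof. by move=> v; rewrite /circ /chord /attached; lia. Qed.

Lemma circ_edge v w : v < w -> w < m -> chord (w - v) ->
  (w = v.+2 -> k - 2 <= v) -> circ v w.
Proof.
move=> vw wm c_wv drop_vw; rewrite /circ wm (ltn_trans vw wm).
have -> : v - w + (w - v) = w - v by lia.
rewrite c_wv /= /dropped; apply/orP; left; apply/andP; split; last by lia.
by apply/nandP; case: eqP => [/drop_vw|]; [right; rewrite -leqNgt|left].
Qed.

Lemma circ_succ v : v.+1 < m -> circ v v.+1.
Proof.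
move=> vm; apply: circ_edge => //; last by move/eqP; rewrite eqn_leq ltnn andbF.
by rewrite subSnn /chord /=; lia.
Qed.

Lemma circ_succ2 v : k - 2 <= v -> v.+2 < m -> circ v v.+2.
Proof.
move=> kv vm; apply: circ_edge => [|//||//]; first by lia.
by rewrite (_ : v.+2 - v = 2) /chord /=; lia.
Qed.

Lemma circ_wrap : circ m.-1 0.
Proof.
rewrite circ_sym; apply: circ_edge => [||| ?]; [by lia..| |by lia].
by rewrite subn0 /chord; lia.
Qed.

Lemma circ_first_hub v : v < m -> circ v m = (v < k - 2).
Proof.
by move=> vm; rewrite /circ /attached ltnn andbF /= (ltn_eqF vm) eqxx; lia.
Qed.

Lemma circ_second_hub v : v < m -> circ v m.+1 = (1 < v < k).
Proof.
move=> vm; rewrite /circ (ltnNge m.+1 m) leqnSn andbF /= /attached.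
by rewrite (ltn_eqF vm) (ltn_eqF (ltnW vm : v < m.+1)) eqxx; lia.
Qed.

(** The chords are the two outer blocks of [k./2] nonzero residues. The middle block contributes
    only the diameter, and only for odd [k], where [m] is even. *)
Lemma count_chord : count chord (iota 0 m) = k.
Proof.
have -> : iota 0 m = iota 0 1 ++ iota 1 k./2 ++
   iota (k./2).+1 (m - k./2 - k./2 - 1) ++ iota (m - k./2) k./2.
  rewrite -[(k./2).+1]add1n.
  rewrite [in X in _ = _ ++ _ ++ _ ++ iota X _](_ : m - k./2 = 1 + k./2 + (m - k./2 - k./2 - 1)); last by lia.
  by rewrite -!iotaD; congr iota; lia.
rewrite !count_cat /= {1}/chord /= !add0n.
rewrite [X in X + _](eq_in_count (a2 := predT)) ?count_predT ?size_iota; last first.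
  by move=> x; rewrite mem_iota /chord /=; lia.
rewrite [X in _ + (_ + X)](eq_in_count (a2 := predT)) ?count_predT ?size_iota; last first.
  by move=> x; rewrite mem_iota /chord /=; lia.
rewrite [X in _ + (X + _)](eq_in_count (a2 := fun d => odd k && (d == m./2))); last first.
  move=> x; rewrite mem_iota /chord /=.
  by move: km_even; rewrite oddM; lia.
case: (boolP (odd k)) => ok /=.
  rewrite (count_uniq_mem _ (iota_uniq _ _)) mem_iota.
  by move: km_even; rewrite oddM ok /=; lia.
by rewrite count_pred0; lia.
Qed.

Lemma chord_opp d : 0 < d < m -> chord (m - d) = chord d.
Proof. by move=> ?; rewrite /chord; lia. Qed.

(** For [w >= v] the differences run over [0 .. m - v - 1]. For [w < v] the difference [v - w] is
    replaced by its opposite [m - (v - w)], and these fill [m - v .. m - 1]. *)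
Lemma count_circulant v : v < m ->
  count (fun w => chord ((v - w) + (w - v))) (iota 0 m) = k.
Proof.
move=> vm; rewrite -count_chord.
transitivity (count chord (iota 0 ((m - v) + v))); last by rewrite subnK // ltnW.
have -> : iota 0 m = iota 0 v ++ iota v (m - v).
  by rewrite -[v in iota v _]add0n -iotaD subnKC // ltnW.
rewrite iotaD !count_cat addnC !add0n.
congr (_ + _).
  rewrite -[v in iota v _]addn0.
  by rewrite iotaDl count_map; apply: eq_count => w /=; congr chord; lia.
rewrite -[m - v in RHS]addn0 iotaDl count_map; apply: eq_in_count => w.
rewrite mem_iota => wv /=; rewrite -chord_opp; last by lia.
by congr chord; lia.
Qed.

Lemma last_iota v n : last v (iota v.+1 n) = v + n.
Proof. by elim: n v => [|n IH] v /=; rewrite ?addn0 // IH addSnnS. Qed.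

Lemma last_rev_iota v n : last (v + n) (rev (iota v n)) = v.
Proof. by case: n => [|n]; rewrite ?addn0 //= rev_cons last_rcons. Qed.

Lemma iota_hubs : iota 0 m.+2 = iota 0 m ++ [:: m; m.+1].
Proof. by rewrite -addn2 iotaD. Qed.

Lemma count_lt a b N : b <= N -> count (fun w => a <= w < b) (iota 0 N) = b - a.
Proof.
move=> bN; case: (leqP a b) => ab; last first.
  rewrite (eq_count (a2 := pred0)) ?count_pred0; [lia|].
  by move=> w /=; lia.
rewrite (_ : N = a + ((b - a) + (N - b))) ?iotaD ?count_cat; last by lia.
rewrite (eq_in_count (a2 := pred0)) ?count_pred0; last by move=> x; rewrite mem_iota /=; lia.
rewrite (eq_in_count (a2 := predT)) ?count_predT; last by move=> x; rewrite mem_iota /=; lia.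
rewrite (eq_in_count (a2 := pred0)) ?count_pred0; last by move=> x; rewrite mem_iota /=; lia.
by rewrite size_iota; lia.
Qed.

(** Hub edges compensate for deletions one by one: [v] loses [v + 2] exactly when it is joined to
    [m], and loses [v - 2] exactly when it is joined to [m + 1]. *)
Lemma count_circ v : v < m -> count (circ v) (iota 0 m.+2) = k.
Proof.
move=> vm; rewrite iota_hubs count_cat -(count_circulant _ vm).
set S := (X in _ = X).
have {S}-> : S = count (circ v) (iota 0 m) +
   count (fun w => dropped v w || dropped w v) (iota 0 m).
  rewrite -count_predUI [X in _ + X](eq_in_count (a2 := pred0)); last first.
    move=> w; rewrite mem_iota /circ /attached /=.
    by case: (dropped v w) (dropped w v) => [] [] /=; lia.
  rewrite count_pred0 addn0; apply: eq_in_count => w; rewrite mem_iota /= => wm.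
  have natt : attached v w || attached w v = false by rewrite /attached; lia.
  rewrite /circ natt vm wm -negb_or orbF /=.
  case: (boolP (dropped v w || dropped w v)) => dr; last by rewrite orbF andbT.
  have -> : v - w + (w - v) = 2 by move: dr; rewrite /dropped; lia.
  by rewrite /chord; lia.
congr (_ + _).
rewrite [X in _ = X](eq_count (a2 := predU (fun w => dropped v w) (fun w => dropped w v))) //.
have := count_predUI (fun w => dropped v w) (fun w => dropped w v) (iota 0 m).
rewrite [X in _ + X](eq_count (a2 := pred0)); last by move=> w; rewrite /dropped /=; lia.
rewrite count_pred0 addn0 => ->; rewrite /dropped.
rewrite [X in _ = X + _](eq_count (a2 := fun w => (v < k - 2) && (w == v.+2))); last first.
  by move=> w; exact: andbC.
rewrite [X in _ = _ + X](eq_count (a2 := fun w => (1 < v < k) && (w == v - 2))); last first.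
  by move=> w; rewrite /dropped; lia.
have c1 (b : bool) x : x < m -> count (fun w => b && (w == x)) (iota 0 m) = b.
  case: b => /= xm; last by rewrite count_pred0.
  by rewrite (count_uniq_mem _ (iota_uniq _ _)) mem_iota /= add0n xm.
have -> : count (fun w => (v < k - 2) && (w == v.+2)) (iota 0 m) = (v < k - 2).
  case: (boolP (v < k - 2)) => vk /=; last by rewrite count_pred0.
  by rewrite (c1 true); lia.
rewrite c1; last by lia.
by rewrite /= circ_first_hub // circ_second_hub // addn0.
Qed.

Lemma count_hub0 : count (circ m) (iota 0 m.+2) = k - 2.
Proof.
rewrite (eq_count (a2 := fun w => 0 <= w < k - 2)) ?count_lt; try lia.
by move=> w; rewrite /circ ltnn /= /attached; lia.
Qed.

Lemma count_hub1 : count (circ m.+1) (iota 0 m.+2) = k - 2.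
Proof.
rewrite (eq_count (a2 := fun w => 2 <= w < k)) ?count_lt; try lia.
by move=> w; rewrite /circ ltnNge leqnSn /= /attached; lia.
Qed.

(** * Hamilton paths in the modified circulant *)

Lemma path_up v n : v + n < m -> path circ v (iota v.+1 n).
Proof.
elim: n v => //= n IH v vn; rewrite IH; last by lia.
by rewrite circ_succ //; lia.
Qed.

Lemma path_down v n : v + n < m -> path circ (v + n) (rev (iota v n)).
Proof.
elim: n => [//|n IH] vn; rewrite -[in iota v _]addn1 iotaD rev_cat /= IH; last by lia.
by rewrite andbT addnS circ_sym circ_succ //; lia.
Qed.

Lemma circ_hub_path : exists p, [/\ path circ m p, last m p = m.+1
  & perm_eq (m :: p) (iota 0 m.+2)].
Proof.
(* Only steps of one around the circle are used inside, and these are never deleted. Vertex 3 is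
   attached to the first hub because [3 < k - 2], and 2 is attached to the second. *)
exists (iota 3 (m - 3) ++ [:: 0; 1; 2; m.+1]); split.
- have -> : m - 3 = (m - 4).+1 by lia.
  have l3 : last m (iota 3 (m - 4).+1) = m.-1.
    by rewrite -[(m - 4).+1]addn1 iotaD cats1 last_rcons; lia.
  rewrite cat_path l3 /= path_up; last by lia.
  rewrite circ_wrap !circ_succ ?circ_second_hub //; try by lia.
  by rewrite circ_sym circ_first_hub; lia.
- by rewrite last_cat.
have -> : iota 0 m.+2 = iota 0 3 ++ iota 3 (m - 3) ++ [:: m; m.+1].
  rewrite iota_hubs (_ : iota 0 m = iota 0 3 ++ iota (0 + 3) (m - 3)) //.
  by rewrite -iotaD subnKC //; lia.
by apply/permP=> a; rewrite /= !count_cat /=; lia.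
Qed.

(* Lists v, v + 2, v + 4, ... up to v + n - 1 and comes back through
   ..., v + 3, v + 1, continuing with acc: this covers the tail of the circulant
   above v when v is far from the attached vertices. *)
Fixpoint zigzag (n v : nat) (acc : seq nat) : seq nat :=
  match n with
  | 0 => acc
  | 1 => v :: acc
  | n'.+2 => v :: zigzag n' v.+2 (v.+1 :: acc)
  end.

(** From [k - 2] upwards no edge [{x, x + 2}] has been deleted; the turn at the top uses a step of
    one. *)
Lemma zigzag_path n v acc : k - 2 <= v -> v.+1 + n < m ->
  path circ v.+1 acc -> path circ v (zigzag n v.+2 (v.+1 :: acc)).
Proof.
have [N] := ubnP n; elim: N n v acc => // N IH [|[|n]] v acc nN kv vn pa /=.
- by rewrite pa circ_succ //; lia.
- by rewrite pa circ_succ2 ?[circ _ v.+1]circ_sym ?circ_succ //; lia.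
rewrite circ_succ2 ?IH //=; try by lia.
by rewrite pa circ_sym circ_succ2 //; lia.
Qed.

Lemma zigzag_last x n v acc y : last x (zigzag n v (y :: acc)) = last y acc.
Proof.
have [N] := ubnP n; elim: N n v acc x y => // N IH [|[|n]] v acc x y nN //=.
by rewrite IH //; lia.
Qed.

Lemma zigzag_perm n v acc : perm_eq (zigzag n v acc) (iota v n ++ acc).
Proof.
have [N] := ubnP n; elim: N n v acc => // N IH [|[|n]] v acc nN //=.
rewrite perm_cons (permPl (IH _ _ _ _)); last by lia.
by apply/permP=> a; rewrite /= !count_cat /=; lia.
Qed.

(** The last inner vertex must be attached to the first hub. According to the position of [v] it is
    1, [v - 1] or 0. *)
Lemma circ_inner_path v : v < m -> exists p, [/\ path circ v p, last v p = m
  & perm_eq (v :: p) (iota 0 m.+1)].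
Proof.
move=> vm.
have Em : iota 0 m.+1 = iota 0 v ++ iota v (m - v) ++ [:: m].
  rewrite catA (_ : iota v _ = iota (0 + v) (m - v)) // -iotaD subnKC; last exact: ltnW.
  by rewrite -[m.+1]addn1 iotaD.
have [v0|v_gt0] := posnP v.
  have [n mE] : exists n, m = n.+3 by exists (m - 3); lia.
  have Er : rev (iota 1 m.-1) = (1 + n.+1) :: rev (iota 1 n.+1).
    by rewrite mE -[n.+3.-1]addn1 iotaD rev_cat.
  exists (rev (iota 1 m.-1) ++ [:: m]); rewrite v0; split.
  - rewrite Er cat_cons [path _ _ _]/= cat_path path_down ?last_rev_iota /=; last by lia.
    rewrite circ_first_hub ?andbT; [|by lia..].
    by rewrite (_ : 1 + n.+1 = m.-1) 1?circ_sym ?circ_wrap //; lia.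
  - by rewrite last_cat.
  rewrite Em v0 subn0 mE -[iota 0 n.+3]/(0 :: iota 1 n.+2).
  apply/permP=> a; rewrite /= !count_cat count_rev /=; lia.
have [w vE] : exists w, v = w.+1 by exists v.-1; lia.
(* For small [v], go up to [m - 1], wrap to 0 and climb to [v - 1], which is below [k - 2]. *)
have [vk|kv] := ltnP v (k - 1).
  exists (iota v.+1 (m - v.+1) ++ iota 0 v ++ [:: m]); split.
  - rewrite !cat_path last_iota path_up; last by lia.
    rewrite vE -[iota 0 w.+1]/(0 :: iota 1 w) /= path_up ?last_iota; last by lia.
    rewrite circ_first_hub ?andbT; [|by lia..].
    by rewrite -vE (_ : v + (m - v.+1) = m.-1) ?circ_wrap /=; lia.
  - by rewrite !last_cat.
  rewrite Em (_ : m - v = (m - v.+1).+1); last by lia.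
  by apply/permP=> a; rewrite /= !count_cat /= ?count_cat /=; lia.
have link : circ 0 m by rewrite circ_first_hub; lia.
have down u : u < m -> path circ u (rev (iota 0 u)) by apply: (path_down 0 u).
have last_down u : last u (rev (iota 0 u)) = 0 by apply: (last_rev_iota 0 u).
have [vm1|vm1] := eqVneq v.+1 m.
  exists (rev (iota 0 v) ++ [:: m]); split.
  - by rewrite cat_path down // last_down /= link.
  - by rewrite last_cat.
  rewrite Em -vm1 subSnn.
  by apply/permP=> a; rewrite /= !count_cat count_rev /=; lia.
(* The zigzag exhausts the vertices above [v] and returns to [v + 1]. The edge to [v - 1] survives
   because [v - 1 >= k - 2], and the descent then ends at 0. *)
exists (zigzag (m - v.+2) v.+2 (v.+1 :: rev (iota 0 v) ++ [:: m])); split.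
- apply: zigzag_path; [lia|lia|].
  have -> : rev (iota 0 v) = w :: rev (iota 0 w).
    by rewrite vE -[w.+1]addn1 iotaD rev_cat.
  rewrite /= cat_path.
  rewrite down ?last_down /= ?link; last by lia.
  by rewrite circ_sym vE circ_succ2 //; lia.
- by rewrite zigzag_last last_cat.
rewrite Em (_ : m - v = (m - v.+2).+2); last by lia.
apply/permP=> a; have /permP/(_ a) := zigzag_perm (m - v.+2) v.+2 (v.+1 :: rev (iota 0 v) ++ [:: m]).
by rewrite /= !count_cat /= !count_cat count_rev /= => ->; lia.
Qed.

End Circulant.

(** * Constructing pieces from relations on numbers *)

(** With hubs [m] and [m + 1], a permutation of an initial segment expresses both distinctness and
    coverage; stopping at [m] omits exactly the second hub. *)
Lemma piece_of_rel k m (e : rel nat) :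
  symmetric e -> irreflexive e -> ~~ e m m.+1 ->
  (forall v, v < m.+2 -> count (e v) (iota 0 m.+2) + 2 * (m <= v) = k) ->
  (exists p, [/\ path e m p, last m p = m.+1 & perm_eq (m :: p) (iota 0 m.+2)]) ->
  (forall v, v < m -> exists p,
    [/\ path e v p, last v p = m & perm_eq (v :: p) (iota 0 m.+1)]) ->
  exists P : piece k, #|P| = m.+2.
Proof.
move=> e_sym e_irr nadj deg trav trace.
pose body := @SGraph 'I_m.+2 (fun x y => e x y) (fun x y => e_sym x y) (fun x => e_irr x).
pose hub d : body := if d then inord m else inord m.+1.
have hubE d : val (hub d) = m + ~~ d by case: d; rewrite /= inordK ?addn0 ?addn1.
have ha : ~~ adj (hub true) (hub false) by rewrite /= !inordK.
clearbody hub; have eq_hub (v : body) d : (v == hub d) = (val v == m + ~~ d) by rewrite -val_eqE hubE.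
have lift (x : body) q n : n <= m.+2 -> path e x q -> perm_eq (val x :: q) (iota 0 n) ->
    exists p : seq body, [/\ path (@adj body) x p, val (last x p) = last (val x) q,
      uniq (x :: p) & forall w, (w \in x :: p) = (val w < n)].
  move=> nm pq xq.
  have [|p Ep] := @lift_seq m.+2 q.
    apply/allP=> y yq; have := perm_mem xq y; rewrite inE yq orbT mem_iota => /esym/andP[_ yn] /=; lia.
  exists p; rewrite -Ep in pq xq *; split.
  - by rewrite path_map in pq.
  - by rewrite last_map.
  - by rewrite -(map_inj_uniq val_inj) (perm_uniq xq) iota_uniq.
  - by move=> w; rewrite -(mem_map val_inj) (perm_mem xq) mem_iota.
have hn : hub true != hub false by rewrite eq_hub hubE; lia.
have pd (v : body) : degree v + 2 * ((v == hub true) || (v == hub false)) = k.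
  rewrite /degree (degree_count m.+2 e) -(deg v (ltn_ord v)) !eq_hub.
  by have vm := ltn_ord v; congr (_ + 2 * nat_of_bool _) => /=; lia.
have hp : exists p, [/\ path (@adj body) (hub true) p,
    last (hub true) p = hub false, uniq (hub true :: p)
    & forall v, v \in hub true :: p].
  have [q [pq lq aq]] := trav; have mE := hubE true; rewrite addn0 in mE.
  have [|||p [pp lp up ap]] := lift (hub true) q m.+2; rewrite ?mE //.
  exists p; split=> // [|v]; last by rewrite ap; apply: ltn_ord.
  by apply: val_inj; rewrite lp mE lq hubE addn1.
have ip (v : body) : v != hub true -> v != hub false ->
    exists p, [/\ path (@adj body) v p, last v p = hub true, uniq (v :: p)
    & forall w, (w \in v :: p) = (w != hub false)].
  rewrite !eq_hub /= => vt vf; have vm : v < m by have := ltn_ord v; lia.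
  have [q [pq lq aq]] := trace v vm.
  have [|p [pp lp up ap]] := lift v q m.+1 _ pq aq => //.
  exists p; split=> // [|w]; first by apply: val_inj; rewrite lp lq hubE addn0.
  by rewrite ap eq_hub /=; have := ltn_ord w; lia.
by exists (Piece k body hub hn ha pd hp ip); rewrite card_ord.
Qed.

Lemma circulant_piece k m : 5 < k -> k < m -> ~~ odd (k * m) ->
  exists P : piece k, #|P| = m.+2.
Proof.
move=> k6 km even.
apply: (piece_of_rel k m (circ k m)).
- exact: circ_sym.
- by apply: circ_irrefl.
- by rewrite /circ /attached; lia.
- move=> v vm2; have [vm|mv] := ltnP v m; first by rewrite count_circ //; lia.
  have [->|->] : v = m \/ v = m.+1 by lia.
    by rewrite count_hub0; lia.
  by rewrite count_hub1; lia.
- by apply: circ_hub_path.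
- by apply: circ_inner_path.
Qed.

(** Vertices 0 and 3, which lack the edge between them, get both hubs and the other four get one, so
    all six have degree 6. *)
Definition small_attached (v w : nat) : bool :=
  (w == 6) && (v < 4) || (w == 7) && (v \in [:: 0; 3; 4; 5]).

(* K_6 on 0..5 without the edge {0, 3}, with hubs 6 and 7. *)
Definition small_rel (v w : nat) : bool :=
  [&& v < 6, w < 6, v != w & (v + w != 3) || (v * w != 0)]
  || (small_attached v w || small_attached w v).

Lemma small_piece : exists P : piece 6, #|P| = 8.
Proof.
apply: (piece_of_rel 6 6 small_rel) => //.
- move=> v w; rewrite /small_rel [small_attached v w || _]orbC.
  by rewrite addnC mulnC eq_sym andbCA.
- move=> v; rewrite /small_rel /small_attached eqxx /= !inE; lia.
- move=> v v8; apply/eqP; move: v v8.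
  have /allP H : all (fun v => count (small_rel v) (iota 0 8) + 2 * (6 <= v) == 6) (iota 0 8) by [].
  by move=> v v8; apply: H; rewrite mem_iota.
- by exists [:: 1; 2; 0; 4; 5; 3; 7].
by case=> [|[|[|[|[|[|//]]]]]] _;
  [exists [:: 1; 3; 4; 5; 2; 6]|exists [:: 0; 4; 3; 5; 2; 6]
  |exists [:: 0; 4; 3; 5; 1; 6]|exists [:: 1; 0; 4; 5; 2; 6]
  |exists [:: 0; 1; 3; 5; 2; 6]|exists [:: 0; 1; 3; 4; 2; 6]].
Qed.

(** * Choosing the three pieces for a given order *)

Lemma glue_three k (P0 P1 P2 : piece k) : exists G : sgraph,
  [/\ order_of G = #|P0| + #|P1| + #|P2|, regular G k,
      homogeneously_traceable G & nonhamiltonian G].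
Proof.
exists (glue k (fun i => nth P0 [:: P0; P1; P2] i)); split.
- by rewrite card_glue !big_ord_recl big_ord0 addn0 addnA.
- exact: glue_regular.
- exact: glue_traceable.
- exact: glue_nonhamiltonian.
Qed.

Theorem theorem1p5 (k n : nat) (hk : 6 <= k) (hn : 6 * (k - 2) <= n)
    (hkn : ~~ odd (k * n)) :
  exists G : sgraph,
    [/\ order_of G = n, regular G k, homogeneously_traceable G
      & nonhamiltonian G].
Proof.
have even_succ : ~~ odd (k * k.+1) by rewrite oddM /=; case: odd.
have [Q cQ] := circulant_piece k k.+1 hk (ltnSn k) even_succ.
have [large|small] := leqP (3 * k + 9) n.
  (* Two copies of [Q] have [2 * (k + 3)] vertices, so the third piece needs [n - 2 * k - 8] inner
     vertices; this exceeds [k] exactly when [n >= 3 * k + 9]. *)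
  have [|||P cP] := circulant_piece k (n - 2 * k - 8) => //; [lia| |].
    by move: hkn; rewrite !oddM !oddB ?oddM /=; [|lia|lia]; rewrite addbF addbF.
  have [G [cG rG tG nG]] := glue_three k P Q Q.
  by exists G; split=> //; rewrite cG cP cQ; lia.
(* From [6 * (k - 2) <= n < 3 * k + 9] follows [k < 7], and then [24 <= n <= 26]. The pieces [R] and
   [Q] have orders 8 and 9. *)
have k6 : k = 6 by lia.
subst k; have [R cR] := small_piece.
have [nE|[nE|nE]] : n = 24 \/ n = 25 \/ n = 26 by lia.
- have [G [cG rG tG nG]] := glue_three 6 R R R.
  by exists G; split=> //; rewrite cG cR nE.
- have [G [cG rG tG nG]] := glue_three 6 R R Q.
  by exists G; split=> //; rewrite cG cR cQ nE.
- have [G [cG rG tG nG]] := glue_three 6 R Q Q.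
  by exists G; split=> //; rewrite cG cR cQ nE.
Qed.
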